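(* Let $(\mathbf X_1,\mathbf Y_1)$ and $(\mathbf X_2,\mathbf Y_2)$ be general correlated sources, both uniformly integrable, and let $(\mathbf X,\mathbf Y)$ be their mixture $P_{X^nY^n}=\alpha_1P_{X_1^nY_1^n}+\alpha_2P_{X_2^nY_2^n}$ with $\alpha_1,\alpha_2>0$, $\alpha_1+\alpha_2=1$. Then \[\overline H_s(\mathbf X|\mathbf Y)\le\lim_{\varepsilon\downarrow0}\limsup_{n\to\infty}\frac1n\sum_{x^n\in\mathcal X^n}P_{X^n}(x^n)\Big[\max_{i=1,2}\overline h_i^\varepsilon(x^n)\Big].\]
   Context: A general correlated source $\{(X^n,Y^n)\}_{n\ge1}$ is an arbitrary sequence of pairs of random variables on $\mathcal X^n\times\mathcal Y^n$, $\mathcal X,\mathcal Y$ finite or countably infinite (no structural assumptions; marginal probabilities positive). Logs base 2. A source is uniformly integrable if $Z_n=\frac1n\log\frac1{P_{X^n|Y^n}(X^n|Y^n)}$ satisfies $\lim_{u\to\infty}\sup_n\sum_{z:|z|\ge u}P_{Z_n}(z)|z|=0$. For a source with distributions $P_{X^nY^n}$, $x^n$ and $\varepsilon\in(0,1]$: $\overline h^\varepsilon(x^n|P_{X^nY^n})=\inf\{a\in\mathbb R:\sum_{y^n:\log(1/P_{X^n|Y^n}(x^n|y^n))>a}P_{Y^n|X^n}(y^n|x^n)\le\varepsilon\}$; $\overline h_i^\varepsilon(x^n)=\overline h^\varepsilon(x^n|P_{X_i^nY_i^n})$; $\overline H_s^\varepsilon(X^n|Y^n)=\sum_{x^n}P_{X^n}(x^n)\overline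 h^\varepsilon(x^n|P_{X^nY^n})$; $\overline H_s(\mathbf X|\mathbf Y)=\lim_{\varepsilon\downarrow0}\limsup_n\frac1n\overline H_s^\varepsilon(X^n|Y^n)$. *)

(* Defs.v *)
From HB Require Import structures.
From mathcomp Require Import all_boot all_order all_algebra.
From mathcomp Require Import all_classical all_reals all_analysis.
Set Implicit Arguments. Unset Strict Implicit. Unset Printing Implicit Defensive.
Import Order.TTheory GRing.Theory Num.Theory.
Import numFieldNormedType.Exports.
Local Open Scope classical_set_scope.
Local Open Scope ring_scope.

Definition source (R : realType) (X Y : choiceType) :=
  forall n : nat, n.-tuple X -> n.-tuple Y -> R.

Definition is_source (R : realType) (X Y : choiceType) (P : source R X Y) :=
  (forall n x y, 0 <= P n x y) /\
  (forall n, (\esum_(xy in [set: n.-tuple X * n.-tuple Y]) (P n xy.1 xy.2)%:E = 1)%E).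

Definition PX (R : realType) (X Y : choiceType) (P : source R X Y) n (x : n.-tuple X) : R :=
  fine (\esum_(y in [set: n.-tuple Y]) (P n x y)%:E).
Definition PY (R : realType) (X Y : choiceType) (P : source R X Y) n (y : n.-tuple Y) : R :=
  fine (\esum_(x in [set: n.-tuple X]) (P n x y)%:E).

Definition pos_marginals (R : realType) (X Y : choiceType) (P : source R X Y) :=
  (forall n (x : n.-tuple X), 0 < PX P x) /\ (forall n (y : n.-tuple Y), 0 < PY P y).

Definition PXgY (R : realType) (X Y : choiceType) (P : source R X Y) n
  (x : n.-tuple X) (y : n.-tuple Y) : R := P n x y / PY P y.
Definition PYgX (R : realType) (X Y : choiceType) (P : source R X Y) n
  (y : n.-tuple Y) (x : n.-tuple X) : R := P n x y / PX P x.

Definition log2 (R : realType) (r : R) : R := ln r / ln 2.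

Definition hbar (R : realType) (X Y : choiceType) (P : source R X Y) n (eps : R)
  (x : n.-tuple X) : \bar R :=
  ereal_inf [set a%:E | a in [set a : R |
     (\esum_(y in [set y : n.-tuple Y | (a < log2 (PXgY P x y)^-1)%R]) (PYgX P y x)%:E
        <= eps%:E)%E]].

Definition Hs_eps (R : realType) (X Y : choiceType) (P : source R X Y) (eps : R) n
  : \bar R :=
  (\esum_(x in [set: n.-tuple X]) (PX P x)%:E * hbar P eps x)%E.

Definition Hs (R : realType) (X Y : choiceType) (P : source R X Y) : \bar R :=
  lim ((fun eps : R => limn_esup (fun n => ((n%:R)^-1)%:E * Hs_eps P eps n)%E)
         @ 0^'+).

Definition Zn (R : realType) (X Y : choiceType) (P : source R X Y) n
  (x : n.-tuple X) (y : n.-tuple Y) : R :=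
  (n%:R)^-1 * log2 (PXgY P x y)^-1.

(* sum_{z : |z| >= u} P_{Z_n}(z) |z|, written over the underlying pairs (x^n,y^n) *)
Definition UI_tail (R : realType) (X Y : choiceType) (P : source R X Y) (u : R) n
  : \bar R :=
  \esum_(xy in [set xy : n.-tuple X * n.-tuple Y | u <= `|Zn P xy.1 xy.2|])
     (P n xy.1 xy.2 * `|Zn P xy.1 xy.2|)%:E.

Definition unif_integrable (R : realType) (X Y : choiceType) (P : source R X Y) :=
  (fun u : R => ereal_sup [set UI_tail P u n | n in [set n : nat | (0 < n)%N]])
    @ +oo --> 0%E.

Definition mixture (R : realType) (X Y : choiceType) (a1 a2 : R)
  (P1 P2 : source R X Y) : source R X Y :=
  fun n x y => a1 * P1 n x y + a2 * P2 n x y.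

(* Main.v *)
(** Write P = a1 P1 + a2 P2 and r_i(y) = PY(y) / (a_i PY_i(y)).  Since a_i P_i <= P,
    log 1/P(x|y) <= log 1/P_i(x|y) + log r_i(y), and log r <= r / ln 2.  Let m(x) be
    at least the sum over i and y of P_i(x,y) PY(y) / PY_i(y), divided by PX(x).  By
    Markov's inequality the conditional probability given x that the component drawn
    is i and r_i > m(x)/eps, summed over i, is at most eps; hence for every x
      hbar^(2 eps)(x) <= max_i hbar_i^eps(x) + m(x) / (eps ln 2).
    The PX-average of m is bounded independently of n, because
    sum_(x,y) P_i(x,y) PY(y) / PY_i(y) = sum_y PY(y) = 1.  So the excess vanishes
    after division by n, and eps -> 0 concludes. *)
Require Import Defs.
From mathcomp Require Import all_boot all_order all_algebra.
From mathcomp Require Import all_classical all_reals all_analysis.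
From mathcomp Require Import ring lra.
Set Implicit Arguments.
Unset Strict Implicit.
Unset Printing Implicit Defensive.
Import Order.TTheory GRing.Theory Num.Theory.
Import numFieldNormedType.Exports.
Local Open Scope classical_set_scope.
Local Open Scope ring_scope.

(** * Unordered sums, upper limits and right limits in the extended reals *)

Lemma subset_esum (R : realType) (T : choiceType) (A B : set T) (f : T -> \bar R) :
  A `<=` B -> (\esum_(i in A) f i <= \esum_(i in B) f i)%E.
Proof.
move=> AB; apply: ge_ereal_sup => _ [X [finX XA] <-].
apply: ereal_sup_ubound; exists X => //; split=> //.
exact: subset_trans AB.
Qed.

(** Comparing finite subsums gives [<=] for every positive scalar; the reverse inequality is the
    same bound applied to [c^-1]. *)
Lemma esumZl (R : realType) (T : choiceType) (A : set T) (f : T -> \bar R) (c : R) :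
  0 < c -> (forall i, 0 <= f i)%E ->
  (\esum_(i in A) (c%:E * f i) = c%:E * \esum_(i in A) f i)%E.
Proof.
move=> c0 f0.
have le (d : R) (g : T -> \bar R) : 0 < d -> (forall i, 0 <= g i)%E ->
    (\esum_(i in A) (d%:E * g i) <= d%:E * \esum_(i in A) g i)%E.
  move=> d0 g0; apply: ge_ereal_sup => _ [X XA <-].
  rewrite -ge0_mule_fsumr//; apply: lee_wpmul2l; first by rewrite lee_fin ltW.
  by apply: ereal_sup_ubound; exists X.
apply/eqP; rewrite eq_le le//=.
rewrite -(@lee_pmul2l _ (c^-1)%:E) ?lte_fin ?invr_gt0//.
rewrite muleA -EFinM mulVf ?gt_eqF// mul1e.
apply: le_trans (le _ _ _ _); rewrite ?invr_gt0//; last first.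
  by move=> i; rewrite mule_ge0// lee_fin ltW.
by apply: le_esum => i _; rewrite muleA -EFinM mulVf ?gt_eqF// mul1e.
Qed.

Lemma exchange_esum (R : realType) (T U : choiceType) (f : T -> U -> \bar R) :
  (forall i j, 0 <= f i j)%E ->
  (\esum_(i in [set: T]) \esum_(j in [set: U]) f i j =
   \esum_(j in [set: U]) \esum_(i in [set: T]) f i j)%E.
Proof.
move=> f0; rewrite !esum_esum//.
rewrite (reindex_esum ([set: U] `*`` (fun=> [set: T])) _ (fun x => (x.2, x.1)))//.
split=> [[i j]//|[i1 i2] [j1 j2] /= _ _ [-> ->]//|[i j] _ /=].
by exists (j, i).
Qed.

(** The perturbation [c / n] is eventually below any positive [e], so it does not affect the upper
    limit. *)
Lemma limn_esup_leD (R : realType) (u v : nat -> \bar R) (c : R) :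
  (forall n, u n <= v n + ((n%:R)^-1 * c)%:E)%E ->
  (limn_esup u <= limn_esup v)%E.
Proof.
move=> uv; apply/lee_addgt0Pr => e e0.
rewrite -leeBlDr//; apply: le_ereal_inf_tmp => _ [A [N _ NA] <-].
rewrite leeBlDr//.
have cvg0 : (fun n => (n%:R)^-1 * c) @ \oo --> (0 : R).
  rewrite -(mul0r c); apply: cvgMr_tmp.
  (* Shifting by one skips the conventional value [0^-1 = 0] and gives the harmonic sequence. *)
  by rewrite -cvg_shiftS; exact: cvg_harmonic.
have [M _ Me] : \forall n \near \oo, (n%:R)^-1 * c < e by apply: (cvgr_lt 0).
apply: (@le_trans _ _ (ereal_sup [set u n | n in [set n | (maxn N M <= n)%N]])).
  apply: ereal_inf_lbound; exists [set n | (maxn N M <= n)%N] => //.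
  by exists (maxn N M).
apply: ge_ereal_sup => _ [n /= + <-]; rewrite geq_max => /andP[Nn Mn].
apply: (le_trans (uv n)); apply: leeD; last by rewrite lee_fin ltW// Me.
by apply: ereal_sup_ubound; exists n => //; exact: NA.
Qed.

(** By monotonicity both limits are suprema over []0, 1[], and there [f e] is bounded by
    [g (e / 2)]; thus the factor 2 is lost in the limit. *)
Lemma lim_at_right_le (R : realType) (f g : R -> \bar R) :
  (forall e d : R, e <= d -> (f d <= f e)%E) -> (forall e d : R, e <= d -> (g d <= g e)%E) ->
  (forall e : R, 0 < e < 2^-1 -> (f (2 * e)%R <= g e)%E) ->
  (lim (f @ 0^'+) <= lim (g @ 0^'+))%E.
Proof.
move=> fmono gmono fg.
have lim_sup (h : R -> \bar R) : (forall e d : R, e <= d -> (h d <= h e)%E) ->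
    lim (h @ 0^'+) = ereal_sup (h @` `]0, 1[).
  move=> hmono; apply: cvg_lim => //.
  apply: (@nonincreasing_at_right_cvge _ h 0 (BLeft 1)).
    by rewrite bnd_simp.
  by move=> d e _ _; exact: hmono.
rewrite !lim_sup//; apply: ge_ereal_sup => _ [e /= + <-].
rewrite in_itv/= => /andP[e0 e1].
apply: (@le_trans _ _ (g (e / 2))).
  have := fg (e / 2); rewrite [2 * _]mulrC divfK//; apply.
  by apply/andP; split; lra.
by apply: ereal_sup_ubound; exists (e / 2) => //=; rewrite in_itv/=; apply/andP; split; lra.
Qed.

Lemma ln2_gt0 (R : realType) : 0 < ln 2 :> R.
Proof. by rewrite ln_gt0// ltr1n. Qed.

(** * Marginals and conditional quantiles of a single source *)

Section source.
Context (R : realType) (X Y : countType) (P : source R X Y).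
Hypothesis srcP : is_source P.

Let P_ge0 n (x : n.-tuple X) (y : n.-tuple Y) : 0 <= P x y. Proof. exact: srcP.1. Qed.

Lemma esum_source n :
  (\esum_(x in [set: n.-tuple X]) \esum_(y in [set: n.-tuple Y]) (P x y)%:E = 1)%E.
Proof.
rewrite esum_esum; last by move=> *; rewrite lee_fin.
rewrite -[RHS](srcP.2 n); congr esum.
by apply/seteqP; split.
Qed.

(** A row sum is at most the total mass 1, so the [fine] in [PX] never meets an infinite value. *)
Lemma PXE n (x : n.-tuple X) :
  ((PX P x)%:E = \esum_(y in [set: n.-tuple Y]) (P x y)%:E)%E.
Proof.
rewrite /PX fineK// ge0_fin_numE; last by apply: esum_ge0 => *; rewrite lee_fin.
apply: le_lt_trans (ltry 1); rewrite -(esum_source n).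
apply: esum_ge; exists [set x]; first by split.
by rewrite fsbig_set1.
Qed.

Lemma PYE n (y : n.-tuple Y) :
  ((PY P y)%:E = \esum_(x in [set: n.-tuple X]) (P x y)%:E)%E.
Proof.
rewrite /PY fineK// ge0_fin_numE; last by apply: esum_ge0 => *; rewrite lee_fin.
apply: le_lt_trans (ltry 1); rewrite -(esum_source n) exchange_esum; last first.
  by move=> *; rewrite lee_fin.
apply: esum_ge; exists [set y]; first by split.
by rewrite fsbig_set1.
Qed.

Lemma esum_PX n : (\esum_(x in [set: n.-tuple X]) (PX P x)%:E = 1)%E.
Proof. by rewrite -(esum_source n); apply: eq_esum => x _; exact: PXE. Qed.

Lemma esum_PY n : (\esum_(y in [set: n.-tuple Y]) (PY P y)%:E = 1)%E.
Proof.
rewrite -(esum_source n) exchange_esum; last by move=> *; rewrite lee_fin.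
by apply: eq_esum => x _; exact: PYE.
Qed.

Lemma le_PY n (x : n.-tuple X) (y : n.-tuple Y) : P x y <= PY P y.
Proof.
rewrite -lee_fin PYE; apply: esum_ge; exists [set x]; first by split.
by rewrite fsbig_set1.
Qed.

Lemma esum_PYgX n (x : n.-tuple X) (A : set (n.-tuple Y)) : 0 < PX P x ->
  (\esum_(y in A) (PYgX P y x)%:E =
   ((PX P x)^-1)%:E * \esum_(y in A) (P x y)%:E)%E.
Proof.
move=> PX0; rewrite -esumZl ?invr_gt0// => [|y]; last by rewrite lee_fin.
by apply: eq_esum => y _; rewrite -EFinM mulrC.
Qed.

Lemma hbar_nincr n (x : n.-tuple X) e d : e <= d -> (hbar P d x <= hbar P e x)%E.
Proof.
move=> ed; apply: ereal_inf_le_tmp => _ [a /= ae <-]; exists a => //=.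
by apply: le_trans ae _; rewrite lee_fin.
Qed.

(** Raising the threshold shrinks the tail, so every real strictly above the infimum is admissible,
    whether or not the infimum is attained. *)
Lemma hbar_ltP n (x : n.-tuple X) e a : (hbar P e x < a%:E)%E ->
  (\esum_(y in [set y : n.-tuple Y | (a < log2 (PXgY P x y)^-1)%R])
     (PYgX P y x)%:E <= e%:E)%E.
Proof.
move=> /ereal_inf_lt[_ [b /= be <-]]; rewrite lte_fin => ba.
by apply: le_trans be; apply: subset_esum => y /=; exact: lt_trans.
Qed.

Hypothesis posP : pos_marginals P.

Lemma log2_PXgY_ge0 n (x : n.-tuple X) (y : n.-tuple Y) :
  0 <= log2 (PXgY P x y)^-1.
Proof.
rewrite /log2 divr_ge0 ?(ltW (ln2_gt0 _))//.
have PY0 := posP.2 _ y.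
(* At a pair of mass zero, [0^-1 = 0] and [ln 0 = 0] make the logarithm 0 rather than infinite. *)
have [P0|P0] := eqVneq (P x y) 0; first by rewrite /PXgY P0 mul0r invr0 ln0.
apply: ln_ge0; rewrite invf_ge1; last by rewrite divr_gt0// lt0r P0 P_ge0.
by rewrite ler_pdivrMr// mul1r le_PY.
Qed.

(** For negative [a] the tail is the whole space, of conditional mass 1, which exceeds [e]. *)
Lemma hbar_ge0 n (x : n.-tuple X) e : e < 1 -> (0 <= hbar P e x)%E.
Proof.
move=> e1; apply: le_ereal_inf_tmp => _ [a /= ae <-]; rewrite lee_fin.
rewrite leNgt; apply/negP => a0.
suff : (1 <= e%:E)%E by rewrite lee_fin leNgt e1.
apply: le_trans ae; rewrite (_ : [set _ | _] = setT); last first.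
  by apply/seteqP; split=> // y _ /=; apply: lt_le_trans a0 (log2_PXgY_ge0 _ _).
have PX0 := posP.1 _ x.
by rewrite esum_PYgX// -PXE -EFinM mulVf ?gt_eqF.
Qed.

End source.

(** * Tail bounds for a source [P] that dominates [c * Q] *)

Section dominated_source.
Context (R : realType) (X Y : countType) (P Q : source R X Y).
Hypotheses (srcP : is_source P) (posP : pos_marginals P).
Hypotheses (srcQ : is_source Q) (posQ : pos_marginals Q).
Variables (c : R) (c0 : 0 < c).
Hypothesis domQ : forall n (x : n.-tuple X) (y : n.-tuple Y), c * Q x y <= P x y.

(** Pointwise form of Markov's inequality. With [r] the quotient of the conditional probabilities,
    the two logarithmic bounds give [m / e < ln r < r], while domination gives
    [c * r <= PY P y / PY Q y]; hence [c * m <= e * (PY P y / PY Q y)]. *)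
Lemma log2_PXgY_dominated n (x : n.-tuple X) (y : n.-tuple Y) (a m e : R) :
  0 < m -> 0 < e -> log2 (PXgY Q x y)^-1 <= a ->
  a + m / (e * ln 2) < log2 (PXgY P x y)^-1 ->
  c * Q x y <= e / m * (Q x y * (PY P y / PY Q y)).
Proof.
move=> m0 e0 Qa aP.
have PYP0 := posP.2 _ y; have PYQ0 := posQ.2 _ y.
have [->|Qxy0] := eqVneq (Q x y) 0; first by rewrite !(mul0r, mulr0).
have Q0 : 0 < Q x y by rewrite lt0r Qxy0 srcQ.1.
have P0 : 0 < P x y by apply: lt_le_trans (domQ x y); rewrite mulr_gt0.
have PgY0 : 0 < PXgY P x y by rewrite divr_gt0.
have QgY0 : 0 < PXgY Q x y by rewrite divr_gt0.
pose r := PXgY Q x y / PXgY P x y.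
have r0 : 0 < r by rewrite divr_gt0.
have mr : m / e < r.
  apply: lt_trans (ln_sublinear r0).
  rewrite lnM ?posrE ?invr_gt0//.
  move: Qa aP; rewrite /log2 lnV ?posrE//.
  have l2 := ln2_gt0 R.
  rewrite ler_pdivrMr// ltr_pdivlMr// mulrDl.
  have -> : m / (e * ln 2) * ln 2 = m / e by field; rewrite !gt_eqF.
  lra.
rewrite ltr_pdivrMr// in mr.
have crP : c * r * P x y = c * Q x y * (PY P y / PY Q y).
  by rewrite /r /PXgY; field; rewrite !gt_eqF.
have cr : c * r <= PY P y / PY Q y.
  by rewrite -(ler_pM2r P0) crP [leRHS]mulrC ler_pM2r ?divr_gt0.
set s := PY P y / PY Q y in cr *.
rewrite mulrAC ler_pdivlMr// mulrAC [c * m * _]mulrC [e * _]mulrCA ler_pM2l//.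
apply: le_trans (_ : e * (c * r) <= _); last by rewrite ler_pM2l.
by rewrite mulrCA ler_pM2l// mulrC ltW.
Qed.

(** Split the tail of [P] by whether [y] also lies in the tail of [Q] above [a]. That part has
    conditional mass at most [e] under [Q]; on the rest the pointwise Markov bound applies, and its
    sum is then extended to all [y]. *)
Lemma esum_log2_PXgY_dominated n (x : n.-tuple X) (a m e : R) :
  0 < m -> 0 < e -> (hbar Q e x < a%:E)%E ->
  (\esum_(y in [set y : n.-tuple Y |
      (a + m / (e * ln 2) < log2 (PXgY P x y)^-1)%R]) (c * Q x y)%:E <=
   (c * (PX Q x * e))%:E +
   (e / m)%:E * \esum_(y in [set: n.-tuple Y])
                  (Q x y * (PY P y / PY Q y))%:E)%E.
Proof.
move=> m0 e0 Qa.
have Q0 y : 0 <= Q x y by exact: srcQ.1.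
have PXQ0 := posQ.1 _ x.
have q0 y : 0 <= Q x y * (PY P y / PY Q y).
  by rewrite mulr_ge0// divr_ge0// ltW ?posP.2 ?posQ.2.
have em0 : 0 < e / m by rewrite divr_gt0.
pose B := [set y : n.-tuple Y | a < log2 (PXgY Q x y)^-1].
apply: (@le_trans _ _ (\esum_(y in [set: n.-tuple Y])
   ((if y \in B then (c%:E * (Q x y)%:E) else 0) +
    (e / m)%:E * (Q x y * (PY P y / PY Q y))%:E))%E).
  apply: le_trans (subset_esum _ _); last exact: subsetT.
  apply: le_esum => y /= aP; case: ifPn => yB.
    by rewrite EFinM leeDl// -EFinM lee_fin mulr_ge0// ltW.
  rewrite add0e -EFinM lee_fin; apply: log2_PXgY_dominated aP => //.
  by rewrite leNgt; apply: contra yB => yB; rewrite inE.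
have cQ0 y : (0 <= c%:E * (Q x y)%:E)%E by rewrite -EFinM lee_fin mulr_ge0// ltW.
rewrite esumD; last 2 first.
- by move=> y _; case: ifP.
- by move=> y _; rewrite -EFinM lee_fin mulr_ge0// ltW.
rewrite -esum_mkcond !esumZl//.
apply: leeD => //; rewrite EFinM lee_wpmul2l ?lee_fin ?(ltW c0)//.
have := hbar_ltP Qa; rewrite esum_PYgX//.
rewrite -(@lee_pmul2l _ (PX Q x)%:E) ?lte_fin//.
by rewrite muleA -!EFinM mulfV ?gt_eqF// mul1e.
Qed.

(** Summing over [x] first turns [Q x y] into [PY Q y], which cancels the denominator. *)
Lemma esum_PY_ratio n :
  (\esum_(x in [set: n.-tuple X]) \esum_(y in [set: n.-tuple Y])
     (Q x y * (PY P y / PY Q y))%:E = 1)%E.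
Proof.
have r0 (y : n.-tuple Y) : 0 < PY P y / PY Q y.
  by rewrite divr_gt0 ?posP.2 ?posQ.2.
rewrite exchange_esum => [|x y]; last by rewrite lee_fin mulr_ge0 ?srcQ.1// ltW.
rewrite -(esum_PY srcP n); apply: eq_esum => y _.
under eq_esum do rewrite mulrC EFinM.
rewrite esumZl// => [|x]; last by rewrite lee_fin srcQ.1.
by rewrite -PYE// -EFinM divfK// gt_eqF// posQ.2.
Qed.

End dominated_source.

(** * The mixture and its one-shot bounds *)

Section mixture.
Context (R : realType) (X Y : countType) (P1 P2 : source R X Y).
Hypotheses (src1 : is_source P1) (pos1 : pos_marginals P1).
Hypotheses (src2 : is_source P2) (pos2 : pos_marginals P2).
Variables (a1 a2 : R).
Hypotheses (a1_gt0 : 0 < a1) (a2_gt0 : 0 < a2) (a12 : a1 + a2 = 1).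

Let P := mixture a1 a2 P1 P2.

Lemma esum_mixture (T : choiceType) (A : set T) (f g : T -> R) :
  (forall i, 0 <= f i) -> (forall i, 0 <= g i) ->
  (\esum_(i in A) (a1 * f i + a2 * g i)%:E =
   a1%:E * (\esum_(i in A) (f i)%:E) + a2%:E * \esum_(i in A) (g i)%:E)%E.
Proof.
move=> f0 g0; have scale_ge0 (c : R) (h : T -> R) : 0 < c -> (forall i, 0 <= h i) ->
    forall i, A i -> (0 <= c%:E * (h i)%:E)%E.
  by move=> c0 h0 i _; rewrite -EFinM lee_fin mulr_ge0// ltW.
under eq_esum do rewrite EFinD !EFinM.
by rewrite esumD; [rewrite !esumZl|exact: scale_ge0|exact: scale_ge0].
Qed.

Lemma is_source_mixture : is_source P.
Proof.
split=> [n x y|n].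
  by rewrite addr_ge0// mulr_ge0 ?src1.1 ?src2.1// ltW.
rewrite esum_mixture => [|xy|xy]; rewrite ?src1.1 ?src2.1//.
by rewrite src1.2 src2.2 !mule1 -EFinD a12.
Qed.

Lemma PX_mixture n (x : n.-tuple X) : PX P x = a1 * PX P1 x + a2 * PX P2 x.
Proof.
apply: EFin_inj; rewrite PXE; last exact: is_source_mixture.
rewrite esum_mixture => [|y|y]; rewrite ?src1.1 ?src2.1//.
by rewrite -!PXE.
Qed.

Lemma PY_mixture n (y : n.-tuple Y) : PY P y = a1 * PY P1 y + a2 * PY P2 y.
Proof.
apply: EFin_inj; rewrite PYE; last exact: is_source_mixture.
rewrite esum_mixture => [|x|x]; rewrite ?src1.1 ?src2.1//.
by rewrite -!PYE.
Qed.

Lemma pos_marginals_mixture : pos_marginals P.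
Proof.
split=> [n x|n y]; rewrite ?PX_mixture ?PY_mixture addr_gt0 ?mulr_gt0//.
- exact: pos1.1.
- exact: pos2.1.
- exact: pos1.2.
- exact: pos2.2.
Qed.

Let srcP := is_source_mixture.
Let posP := pos_marginals_mixture.

Let dom1 n (x : n.-tuple X) (y : n.-tuple Y) : a1 * P1 x y <= P x y.
Proof. by rewrite lerDl mulr_ge0 ?src2.1// ltW. Qed.

Let dom2 n (x : n.-tuple X) (y : n.-tuple Y) : a2 * P2 x y <= P x y.
Proof. by rewrite lerDr mulr_ge0 ?src1.1// ltW. Qed.

(** Kept in the extended reals: finiteness at each [x] comes only from the total over [x] being
    1. *)
Let ratio (Q : source R X Y) n (x : n.-tuple X) : \bar R :=
  \esum_(y in [set: n.-tuple Y]) (Q n x y * (PY P y / PY Q y))%:E.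

Let ratio_ge0 (Q : source R X Y) n (x : n.-tuple X) :
  is_source Q -> pos_marginals Q -> (0 <= ratio Q x)%E.
Proof.
move=> srcQ posQ; apply: esum_ge0 => y _.
by rewrite lee_fin mulr_ge0 ?srcQ.1// divr_ge0// ltW ?posP.2 ?posQ.2.
Qed.

Lemma hbar_mixture_le n (x : n.-tuple X) (e m : R) : 0 < e < 1 -> 0 < m ->
  (ratio P1 x + ratio P2 x <= (m * PX P x)%:E)%E ->
  (hbar P (2 * e)%R x <=
   maxe (hbar P1 e x) (hbar P2 e x) + (m / (e * ln 2))%:E)%E.
Proof.
move=> /andP[e0 e1] m0 ratio_le; have PX0 := posP.1 _ x.
(* A real [a] strictly above both quantiles is admissible for both components, so the two tail
   bounds can be added. *)
have hbar_le (a : R) : (maxe (hbar P1 e x) (hbar P2 e x) < a%:E)%E ->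
    (hbar P (2 * e)%R x <= (a + m / (e * ln 2))%:E)%E.
  rewrite gt_max => /andP[h1 h2].
  apply: ereal_inf_lbound; exists (a + m / (e * ln 2)) => //=.
  rewrite esum_PYgX// -(@lee_pmul2l _ (PX P x)%:E) ?lte_fin//.
  rewrite muleA -!EFinM mulfV ?gt_eqF// mul1e.
  under eq_esum do rewrite EFinD.
  rewrite esumD; last 2 first.
  - by move=> y _; rewrite lee_fin mulr_ge0 ?src1.1// ltW.
  - by move=> y _; rewrite lee_fin mulr_ge0 ?src2.1// ltW.
  have le1 := esum_log2_PXgY_dominated posP src1 pos1 a1_gt0 dom1 m0 e0 h1.
  have le2 := esum_log2_PXgY_dominated posP src2 pos2 a2_gt0 dom2 m0 e0 h2.
  apply: le_trans (leeD le1 le2) _.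
  rewrite addeACA -ge0_muleDr ?ratio_ge0//.
  have em0 : (0 <= (e / m)%:E)%E by rewrite lee_fin divr_ge0// ltW.
  apply: le_trans (leeD (lexx _) (lee_wpmul2l em0 ratio_le)) _.
  rewrite -EFinM -!EFinD lee_fin le_eqVlt; apply/orP; left; apply/eqP.
  (* The quantile parts add up to [e * PX P x] and the Markov parts contribute
     [(e / m) * (m * PX P x)], whence the level [2 * e]. *)
  by rewrite PX_mixture; field; rewrite gt_eqF.
(* Nonnegativity rules out the value -oo; at a real value [r], the bound is used at [r + d] with [d]
   arbitrarily small. *)
have : (0 <= maxe (hbar P1 e x) (hbar P2 e x))%E by rewrite le_max hbar_ge0.
case: (maxe _ _) hbar_le => [r| |]// hbar_le _; last by rewrite addye// leey.
apply/lee_addgt0Pr => d d0; apply: le_trans (hbar_le (r + d) _) _.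
  by rewrite lte_fin ltrDl.
by rewrite -!EFinD lee_fin addrAC.
Qed.

(** The constant 3 collects three unit totals: the two sums of [ratio] and the mass of [PX P]. *)
Lemma Hs_eps_mixture_le n (e : R) : 0 < e < 2^-1 ->
  (Hs_eps P (2 * e)%R n <=
   \esum_(x in [set: n.-tuple X])
      (PX P x)%:E * maxe (hbar P1 e x) (hbar P2 e x) +
   (3 / (e * ln 2))%:E)%E.
Proof.
move=> /andP[e0 e2].
have e1 : e < 1 by lra.
have K0 : 0 < (e * ln 2)^-1 by rewrite invr_gt0 mulr_gt0// ln2_gt0.
have sum1 := esum_PY_ratio srcP posP src1 pos1 n.
have sum2 := esum_PY_ratio srcP posP src2 pos2 n.
(* Each [ratio Q x] is one term of a nonnegative sum equal to 1, so [m] can be chosen real. *)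
have ratio_fin (Q : source R X Y) (x : n.-tuple X) :
    is_source Q -> pos_marginals Q ->
    (\esum_(x in [set: n.-tuple X]) ratio Q x = 1)%E -> ratio Q x \is a fin_num.
  move=> srcQ posQ sumQ; rewrite ge0_fin_numE ?ratio_ge0//.
  apply: le_lt_trans (ltry 1); rewrite -sumQ.
  by apply: esum_ge; exists [set x]; [split|rewrite fsbig_set1].
have max0 (x : n.-tuple X) : (0 <= maxe (hbar P1 e x) (hbar P2 e x))%E.
  by rewrite le_max hbar_ge0.
have PX0 (x : n.-tuple X) : 0 < PX P x by exact: posP.1.
have rest0 (x : n.-tuple X) : (0 <= ratio P1 x + ratio P2 x + (PX P x)%:E)%E.
  by rewrite !adde_ge0 ?ratio_ge0// lee_fin ltW.
apply: (@le_trans _ _ (\esum_(x in [set: n.-tuple X])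
    ((PX P x)%:E * maxe (hbar P1 e x) (hbar P2 e x) +
     (e * ln 2)^-1%:E * (ratio P1 x + ratio P2 x + (PX P x)%:E)))%E).
  apply: le_esum => x _.
  pose s := fine (ratio P1 x + ratio P2 x).
  have sE : (ratio P1 x + ratio P2 x)%E = s%:E.
    by rewrite fineK// fin_numD !ratio_fin.
  have s0 : 0 <= s by rewrite fine_ge0// adde_ge0// ratio_ge0.
  (* The summand 1 only serves to make m positive. *)
  pose m := s / PX P x + 1.
  have m0 : 0 < m by rewrite ltr_wpDl// divr_ge0// ltW.
  have mPX : m * PX P x = s + PX P x by rewrite mulrDl divfK ?mul1r// gt_eqF.
  have e01 : 0 < e < 1 by rewrite e0.
  have le_m : (ratio P1 x + ratio P2 x <= (m * PX P x)%:E)%E.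
    by rewrite mPX sE lee_fin lerDl ltW.
  have PXx0 : (0 <= (PX P x)%:E)%E by rewrite lee_fin ltW.
  apply: le_trans (lee_wpmul2l PXx0 (hbar_mixture_le e01 m0 le_m)) _.
  rewrite ge0_muleDr//; last by rewrite lee_fin mulr_ge0// ltW.
  rewrite leeD2l// sE -EFinD -!EFinM lee_fin -mPX.
  by rewrite mulrA mulrC [PX P x * m]mulrC.
rewrite esumD; last 2 first.
- by move=> x _; rewrite mule_ge0// lee_fin ltW.
- by move=> x _; rewrite mule_ge0// lee_fin ltW.
rewrite leeD2l// esumZl// esumD; last 2 first.
- by move=> x _; rewrite adde_ge0// ratio_ge0.
- by move=> x _; rewrite lee_fin ltW.
rewrite esumD; last 2 first.
- by move=> x _; exact: ratio_ge0.
- by move=> x _; exact: ratio_ge0.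
rewrite sum1 sum2 esum_PX// -!EFinD -EFinM lee_fin mulrC.
by rewrite (_ : 1 + 1 + 1 = 3 :> R)//; ring.
Qed.

End mixture.

(** * Normalisation by [n] and passage to the limit *)

Theorem theorem12 (R : realType) (X Y : countType) (P1 P2 : source R X Y)
  (a1 a2 : R) :
  is_source P1 -> is_source P2 ->
  pos_marginals P1 -> pos_marginals P2 ->
  unif_integrable P1 -> unif_integrable P2 ->
  0 < a1 -> 0 < a2 -> a1 + a2 = 1 ->
  (Hs (mixture a1 a2 P1 P2) <=
   lim ((fun eps : R =>
          limn_esup (fun n => ((n%:R)^-1)%:E *
            \esum_(x in [set: n.-tuple X])
              (PX (mixture a1 a2 P1 P2) x)%:E *
              maxe (hbar P1 eps x) (hbar P2 eps x))) @ 0^'+))%E.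
Proof.
move=> src1 src2 pos1 pos2 _ _ a1_gt0 a2_gt0 a12.
have posP : pos_marginals (mixture a1 a2 P1 P2) by exact: pos_marginals_mixture.
have limn_esup_le (u v : nat -> \bar R) :
    (forall n, u n <= v n)%E -> (limn_esup u <= limn_esup v)%E.
  by move=> uv; apply: (@limn_esup_leD _ _ _ 0) => n; rewrite mulr0 adde0.
have invn0 n : (0 <= ((n%:R)^-1 : R)%:E)%E by rewrite lee_fin invr_ge0.
have PX0 n (x : n.-tuple X) : (0 <= (PX (mixture a1 a2 P1 P2) x)%:E)%E.
  by rewrite lee_fin ltW// posP.1.
apply: lim_at_right_le => [e d ed|e d ed|e e2].
- apply: limn_esup_le => n; apply: lee_wpmul2l => //; apply: le_esum => x _.
  by apply: lee_wpmul2l => //; exact: hbar_nincr.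
- apply: limn_esup_le => n; apply: lee_wpmul2l => //; apply: le_esum => x _.
  by apply: lee_wpmul2l => //; rewrite ge_max !le_max !hbar_nincr// orbT.
(* For fixed [e] the excess is independent of [n], so division by [n] removes it. *)
apply: (@limn_esup_leD _ _ _ (3 / (e * ln 2))) => n.
have K0 : (0 <= (3 / (e * ln 2))%:E)%E.
  have /andP[e0 _] := e2.
  by rewrite lee_fin divr_ge0// mulr_ge0// ltW// ln2_gt0.
rewrite EFinM -ge0_muleDr//; last first.
  apply: esum_ge0 => x _; rewrite mule_ge0// le_max hbar_ge0//.
  by have /andP[_] := e2; lra.
apply: lee_wpmul2l => //.
exact: Hs_eps_mixture_le.
Qed.
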